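(* For any integer $n\geq 1$ and complex numbers $a,x$ (with $axq^k\neq 1$ for $0\le k\le n-1$), $$\sum_{k=1}^n k\left[{n \atop k}\right]_q q^{\binom{k}{2}} (-ax)^{k-1}=(ax; q)_n \sum_{k=0}^{n-1} \frac{q^k }{1-a x q^k}.$$
   Context: $q$ is a complex number with $0<|q|<1$. For an integer $n\ge 0$, $(a;q)_n=\prod_{j=0}^{n-1}(1-aq^j)$, and the $q$-binomial coefficient is $\left[{n\atop k}\right]_q=\frac{(q;q)_n}{(q;q)_k(q;q)_{n-k}}$. The convention $0^0=1$ is used. *)

(* Defs.v *)
From HB Require Import structures.
From mathcomp Require Import all_boot all_order all_algebra.
From mathcomp Require Import reals complex.

Set Implicit Arguments.
Unset Strict Implicit.
Unset Printing Implicit Defensive.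

Import Order.TTheory GRing.Theory Num.Theory.
Local Open Scope ring_scope.

Definition qpochhammer (F : fieldType) (a q : F) (n : nat) : F :=
  \prod_(0 <= j < n) (1 - a * q ^+ j).

(* Meaningful for k <= n only: n - k is truncated subtraction. *)
Definition qbinomial (F : fieldType) (q : F) (n k : nat) : F :=
  qpochhammer q q n / (qpochhammer q q k * qpochhammer q q (n - k)).

(* Main.v *)
(** Both sides equal [- P^`().[a x]] for the polynomial
    [P = \prod_(j < n) (1 - q ^+ j 'X)]: the left one by differentiating the
    expansion of [P] given by the q-binomial theorem term by term, the right one
    by taking the logarithmic derivative of the product. *)
Require Import Defs.
From HB Require Import structures.
From mathcomp Require Import all_boot all_order all_algebra.
From mathcomp Require Import reals complex.
From mathcomp Require Import ring.

Set Implicit Arguments.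
Unset Strict Implicit.
Unset Printing Implicit Defensive.

Import Order.TTheory GRing.Theory Num.Theory.
Local Open Scope ring_scope.
Local Open Scope complex_scope.

Lemma qpochhammer0 (F : fieldType) (a q : F) : qpochhammer a q 0 = 1.
Proof. by rewrite /qpochhammer big_geq. Qed.

Lemma qpochhammerS (F : fieldType) (a q : F) (n : nat) :
  qpochhammer a q n.+1 = qpochhammer a q n * (1 - a * q ^+ n).
Proof. by rewrite /qpochhammer big_nat_recr. Qed.

(** Over a general field, [q] not being a root of unity is what keeps the denominators of the
    q-binomials away from zero. *)
Lemma qpochhammer_neq0 (F : fieldType) (q : F) (n : nat) :
  (forall j, q ^+ j.+1 != 1) -> qpochhammer q q n != 0.
Proof.
move=> hq; elim: n => [|n IHn]; first by rewrite qpochhammer0 oner_eq0.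
by rewrite qpochhammerS mulf_neq0 // -exprS subr_eq0 eq_sym hq.
Qed.

Section QBinomial.

Variables (F : fieldType) (q : F).
Hypothesis hq : forall j, q ^+ j.+1 != 1.

Lemma qbinomial0 (n : nat) : qbinomial q n 0 = 1.
Proof. by rewrite /qbinomial qpochhammer0 subn0 mul1r divff ?qpochhammer_neq0. Qed.

Lemma qbinomialnn (n : nat) : qbinomial q n n = 1.
Proof. by rewrite /qbinomial subnn qpochhammer0 mulr1 divff ?qpochhammer_neq0. Qed.

(** This is the form of the q-Pascal rule that matches peeling the last factor off the product. At
    [k = n] it fails: truncated subtraction makes [qbinomial q n n.+1] nonzero. *)
Lemma qbinomialS (n k : nat) : (k < n)%N ->
  qbinomial q n.+1 k.+1 = qbinomial q n k.+1 + q ^+ (n - k) * qbinomial q n k.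
Proof.
(* Writing [n] as [k + m.+1] removes all subtractions, leaving a rational identity in [q ^+ k] and
   [q ^+ m]. *)
move=> lt_kn; have [m ->] : exists m, n = (k + m.+1)%N.
  by exists (n - k.+1)%N; rewrite -addSnnS subnKC.
have [e1 e2 e3] : [/\ (k + m.+1).+1 - k.+1 = m.+1, k + m.+1 - k.+1 = m
    & k + m.+1 - k = m.+1]%N by rewrite subSS addKn -addSnnS addKn.
have hk := qpochhammer_neq0 k hq; have hm := qpochhammer_neq0 m hq.
have hk1 : 1 - q * q ^+ k != 0 by rewrite -exprS subr_eq0 eq_sym.
have hm1 : 1 - q * q ^+ m != 0 by rewrite -exprS subr_eq0 eq_sym.
rewrite /qbinomial e1 e2 e3 (qpochhammerS q q (k + m.+1)) !(qpochhammerS q q k).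
rewrite !(qpochhammerS q q m) exprD !exprS.
by field; rewrite hk hm hk1 hm1.
Qed.

Definition qpochhammer_poly (n : nat) : {poly F} :=
  \prod_(0 <= j < n) (1 - q ^+ j *: 'X).

Lemma qpochhammer_polyS (n : nat) :
  qpochhammer_poly n.+1 = qpochhammer_poly n * (1 - q ^+ n *: 'X).
Proof. by rewrite /qpochhammer_poly big_nat_recr. Qed.

Lemma horner_qpochhammer_poly (n : nat) (t : F) :
  (qpochhammer_poly n).[t] = qpochhammer t q n.
Proof.
rewrite /qpochhammer_poly /qpochhammer horner_prod.
by apply: eq_bigr => j _; rewrite !hornerE mulrC.
Qed.

Lemma coef_qpochhammer_polyS (n k : nat) :
  (qpochhammer_poly n.+1)`_k.+1 =
    (qpochhammer_poly n)`_k.+1 - q ^+ n * (qpochhammer_poly n)`_k.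
Proof. by rewrite qpochhammer_polyS mulrBr mulr1 -scalerAr !coefE. Qed.

Lemma coef_qpochhammer_poly_gt (n k : nat) :
  (n < k)%N -> (qpochhammer_poly n)`_k = 0.
Proof.
elim: n k => [|n IHn] [|k] // lt_nk.
  by rewrite /qpochhammer_poly big_geq // coef1.
by rewrite coef_qpochhammer_polyS !IHn ?mulr0 ?subr0 // ltnW.
Qed.

(** Induction on [n]: since 'C(k.+1, 2) = 'C(k, 2) + k, the coefficient recursion turns into the
    q-Pascal rule. *)
Lemma coef_qpochhammer_poly (n k : nat) : (k <= n)%N ->
  (qpochhammer_poly n)`_k = qbinomial q n k * q ^+ 'C(k, 2) * (-1) ^+ k.
Proof.
elim: n k => [|n IHn] [|k] // le_kn.
- by rewrite /qpochhammer_poly big_geq // coef1 qbinomial0 !mulr1.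
- rewrite qpochhammer_polyS mulrBr mulr1 -scalerAr !coefE mulr0 subr0.
  by rewrite IHn // !qbinomial0.
rewrite coef_qpochhammer_polyS binS bin1 exprD (exprS (-1)) (IHn k) //.
(* The leading coefficient is treated apart, outside the range of [qbinomialS]; there the first term
   of the recursion vanishes by degree. *)
move: le_kn; rewrite ltnS leq_eqVlt => /predU1P[->|lt_kn].
  by rewrite coef_qpochhammer_poly_gt // !qbinomialnn; ring.
rewrite IHn // qbinomialS // binS bin1 exprD (exprS (-1)).
(* The factor [q ^+ n] splits as [q ^+ (n - k) * q ^+ k]: one part for the q-Pascal rule, the other
   for the binomial exponent. *)
by rewrite -[X in q ^+ X * (_ * _)](subnK (ltnW lt_kn)) exprD; ring.
Qed.

Lemma qbinomial_theorem (n : nat) :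
  qpochhammer_poly n =
  \poly_(k < n.+1) (qbinomial q n k * q ^+ 'C(k, 2) * (-1) ^+ k).
Proof.
apply/polyP => k; rewrite coef_poly ltnS.
by case: leqP => [/coef_qpochhammer_poly | /coef_qpochhammer_poly_gt].
Qed.

Lemma horner_deriv_qpochhammer_poly_sum (n : nat) (t : F) :
  (qpochhammer_poly n)^`().[t] =
  - \sum_(1 <= k < n.+1)
      k%:R * qbinomial q n k * q ^+ 'C(k, 2) * (- t) ^+ (k - 1).
Proof.
rewrite qbinomial_theorem poly_def raddf_sum horner_sum.
(* Passing to a sum over a range of naturals lets the constant term be split off; its derivative is
   zero, so the sum starts at 1. *)
rewrite -(big_mkord xpredT (fun k => ((qbinomial q n k * q ^+ 'C(k, 2) *
  (-1) ^+ k) *: 'X^k)^`().[t])) big_nat_recl //=.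
rewrite derivZ derivXn mulr0n scaler0 horner0 add0r big_add1 /= -sumrN.
apply: eq_bigr => k _; rewrite derivZ derivXn hornerZ hornerMn hornerXn /=.
by rewrite subn1 /= (exprS (-1)) [(- t) ^+ _]exprNn -mulr_natr; ring.
Qed.

(** By induction with the product rule: the new factor contributes [- q ^+ n * qpochhammer t q n],
    which is the last summand once [1 - t * q ^+ n] cancels. *)
Lemma horner_deriv_qpochhammer_poly_log (n : nat) (t : F) :
  (forall k, (k < n)%N -> t * q ^+ k != 1) ->
  (qpochhammer_poly n)^`().[t] =
  - (qpochhammer t q n * \sum_(0 <= k < n) (q ^+ k / (1 - t * q ^+ k))).
Proof.
elim: n => [|n IHn] ht.
  by rewrite /qpochhammer_poly !big_geq // derivC horner0 mulr0 oppr0.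
have ht1 : 1 - t * q ^+ n != 0 by rewrite subr_eq0 eq_sym ht.
rewrite qpochhammer_polyS derivM derivB derivC derivZ derivX big_nat_recr //=.
rewrite !hornerE horner_qpochhammer_poly IHn => [|k lt_kn]; last first.
  by rewrite ht // ltnW.
by rewrite qpochhammerS; field.
Qed.

End QBinomial.

Theorem theorem2p3 (R : realType) (q : R[i]) (hq : 0 < `|q| < 1)
    (n : nat) (hn : (1 <= n)%N) (a x : R[i])
    (hax : forall k : nat, (0 <= k <= n - 1)%N -> a * x * q ^+ k != 1) :
  \sum_(1 <= k < n.+1)
     k%:R * qbinomial q n k * q ^+ 'C(k, 2) * (- (a * x)) ^+ (k - 1) =
  qpochhammer (a * x) q n *
    \sum_(0 <= k < n) (q ^+ k / (1 - a * x * q ^+ k)).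
Proof.
(* Positive powers of [q] have norm below 1, so [q] is not a root of unity. *)
have hq1 j : q ^+ j.+1 != 1.
  case/andP: hq => _ lt_q1; apply/eqP => /(congr1 Num.norm).
  by move/eqP; rewrite normr1 normrX lt_eqF // exprn_ilt1.
apply: oppr_inj; rewrite -(horner_deriv_qpochhammer_poly_sum hq1).
apply: horner_deriv_qpochhammer_poly_log => k lt_kn.
by apply: hax; rewrite leq_subRL ?add1n.
Qed.
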